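(* For every $n\ge1$ there is a bijection between the set of matchings on $[2n]$ that avoid the pattern $12312$ and the set of oscillating tableaux of length $2n$, $\emptyset=\lambda^0,\lambda^1,\dots,\lambda^{2n}=\emptyset$, such that every $\lambda^i$ is a partition of shape $(k)$ (for some $k\ge0$) or $(k,1)$ (for some $k\ge1$), and such that no partition $\lambda^i=(k,1)$ is immediately followed by $\lambda^{i+1}=(k+1,1)$.
   Context: An oscillating tableau of length $\ell$ is a sequence of partitions (Young diagrams) $\emptyset=\lambda^0,\lambda^1,\dots,\lambda^{\ell}=\emptyset$ such that each $\lambda^i$ is obtained from $\lambda^{i-1}$ by adding one square or removing one square. A matching on $[2n]$ is a partition of $[2n]$ into $n$ blocks of size two (edges). The canonical sequential form of a matching with $n$ edges is the word of length $2n$ obtained by labeling edges $1,\dots,n$ in increasing order of their smaller elements and writing at each position the label of the edge containing it. Words $a_1\cdots a_k$, $b_1\cdots b_k$ are order-isomorphic if $a_i<a_j\iff b_i<b_j$ for all $i,j$. A matching contains a pattern $\tau$ if its canonical sequential form has a subsequence order-isomorphic to $\tau$, and avoids $\tau$ otherwise. *)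

(* Defs.v *)
From HB Require Import structures.
From mathcomp Require Import all_boot.
Set Implicit Arguments.
Unset Strict Implicit.
Unset Printing Implicit Defensive.

(* The ground set [2n] is represented by 'I_(2 * n), i.e. 0-based. *)
Definition is_matching (n : nat) (M : {set {set 'I_(2 * n)}}) : bool :=
  [&& partition M [set: 'I_(2 * n)], #|M| == n & [forall B in M, #|B| == 2]].

(* The neutral value m is never reached on a nonempty B. *)
Definition edge_min (m : nat) (B : {set 'I_m}) : nat :=
  \big[minn/m]_(i in B) (i : nat).

(* The rank of the edge B, counted from 1, when the edges are listed by
   increasing smaller element. *)
Definition edge_label (m : nat) (M : {set {set 'I_m}}) (B : {set 'I_m}) : nat :=
  #|[set C in M | edge_min C <= edge_min B]|.

Definition canonical_form (m : nat) (M : {set {set 'I_m}}) : seq nat :=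
  [seq edge_label M (pblock M i) | i <- enum 'I_m].

Definition order_iso (a b : seq nat) : bool :=
  (size a == size b) &&
  [forall i : 'I_(size a), forall j : 'I_(size a),
     (nth 0 a i < nth 0 a j) == (nth 0 b i < nth 0 b j)].

(* The subsequences of w are the words mask c w. *)
Definition word_contains (w tau : seq nat) : bool :=
  [exists c : (size w).-tuple bool, order_iso (mask c w) tau].

Definition avoids (m : nat) (M : {set {set 'I_m}}) (tau : seq nat) : bool :=
  ~~ word_contains (canonical_form M) tau.

(* Partitions are written without zero parts, so the empty one is [::]. *)
Definition is_partn (la : seq nat) : bool := sorted geq la && (0 \notin la).

(* incr_nth la (size la) opens a new row. *)
Definition add_square (la mu : seq nat) : bool :=
  [exists i : 'I_(size la).+1, mu == incr_nth la i].

Definition osc_step (la mu : seq nat) : bool :=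
  add_square la mu || add_square mu la.

Definition is_osc_tableau (l : nat) (t : l.+1.-tuple (seq nat)) : bool :=
  [&& all is_partn t, tnth t ord0 == [::], tnth t ord_max == [::]
    & sorted osc_step t].

(* On partitions: shape (k) with k >= 0, where (0) is [::], or (k, 1) with
   k >= 1; positivity of k comes from is_partn. *)
Definition row_or_near_row (la : seq nat) : bool :=
  match la with
  | [::] | [:: _] | [:: _; 1] => true
  | _ => false
  end.

(* la = (k, 1) and mu = (k + 1, 1) for some k. *)
Definition forbidden_step (la mu : seq nat) : bool :=
  match la, mu with
  | [:: k; 1], [:: k'; 1] => k' == k.+1
  | _, _ => false
  end.

Definition restricted_osc_tableau (l : nat) (t : l.+1.-tuple (seq nat)) : bool :=
  [&& is_osc_tableau t, all row_or_near_row t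
    & sorted [rel la mu | ~~ forbidden_step la mu] t].

(* Main.v *)
Require Import Defs.
From HB Require Import structures.
From mathcomp Require Import all_boot.
From mathcomp Require Import zify.

Set Implicit Arguments.
Unset Strict Implicit.
Unset Printing Implicit Defensive.

(** Read a matching from left to right. Avoiding 12312 means that a closer
    closes either the largest open label, or the second largest one when the
    largest is the last label opened. So in each descent of the underlying Dyck
    path, of length [r] from height [h], one is free to choose how many second
    largest labels are closed before the last opened label: an integer between
    [0] and [minn r h.-1]. In a restricted tableau, a square added in the second
    row can only be followed by removals until that square is removed, and the
    number of these removals is an integer in the same range. Both families are
    therefore the accepted words of transition systems whose numbers of runs
    satisfy the same recursion, and equally long duplicate-free enumerations
    give the bijection. *)

(** * Runs of labelled transition systems *)

Fixpoint runs (S L : Type) (succ : S -> seq (L * S)) (fin : pred S)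
    (N : nat) (s : S) : seq (seq L) :=
  if N is N'.+1 then
    [seq p.1 :: w | p <- succ s, w <- runs succ fin N' p.2]
  else if fin s then [:: [::]] else [::].

Fixpoint accepts (S : Type) (L : eqType) (succ : S -> seq (L * S))
    (fin : pred S) (s : S) (w : seq L) : bool :=
  if w is x :: w' then
    has (fun p => (p.1 == x) && accepts succ fin p.2 w') (succ s)
  else fin s.

Lemma mem_runs (S L : eqType) (succ : S -> seq (L * S)) (fin : pred S) N s w :
  (w \in runs succ fin N s) = (size w == N) && accepts succ fin s w.
Proof.
elim: N s w => [|N IH] s [|x w] /=.
- by case: (fin s); rewrite ?inE.
- by case: (fin s); rewrite ?inE.
- by apply/negP => /allpairsPdep [p [v []]].
apply/allpairsPdep/andP.
  move=> [p [v [sp rv [-> ->]]]].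
  move: rv; rewrite IH => /andP [/eqP <- av]; split=> //.
  by apply/hasP; exists p; rewrite // eqxx.
move=> [sw /hasP [p sp /andP [/eqP <- aw]]].
by exists p, w; split=> //; rewrite IH aw andbT.
Qed.

Lemma uniq_map_inj_in (T1 T2 : eqType) (f : T1 -> T2) (s : seq T1) :
  uniq [seq f x | x <- s] -> {in s &, injective f}.
Proof.
elim: s => //= a s IH /andP [/negP nfa /IH inj] x y.
rewrite !inE => /predU1P [->|sx] /predU1P [->|sy] // fxy.
- by case: nfa; rewrite fxy map_f.
- by case: nfa; rewrite -fxy map_f.
- exact: inj.
Qed.

(** If the successors of a state carry distinct labels, the first letter of a word determines the
    next state, so no word arises twice. The invariant [I] restricts this requirement to suitable
    states. *)
Lemma runs_uniq (S L : eqType) (succ : S -> seq (L * S)) (fin : pred S)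
    (I : S -> Prop) :
    (forall s p, I s -> p \in succ s -> I p.2) ->
    (forall s, I s -> uniq (unzip1 (succ s))) ->
  forall N s, I s -> uniq (runs succ fin N s).
Proof.
move=> stepI uniqI; elim=> [|N IH] s Is /=; first by case: (fin s).
have us := uniqI s Is.
apply: allpairs_uniq_dep => [|p sp|].
- exact: map_uniq us.
- exact/IH/(stepI s).
move=> _ _ /allpairsPdep [p [w [sp rw ->]]] /allpairsPdep [q [v [sq rv ->]]] /=.
case=> pq ->.
by rewrite (uniq_map_inj_in us sp sq pq).
Qed.

Lemma size_runsS (S L : Type) (succ : S -> seq (L * S)) (fin : pred S) N s :
  size (runs succ fin N.+1 s) =
  sumn [seq size (runs succ fin N p.2) | p <- succ s].
Proof. by rewrite /= size_allpairs_dep. Qed.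

(** * The two transition systems and their equal numbers of runs *)

(* [m] is the last label opened, [b] tells whether it is still open and [st]
   lists the other open labels in decreasing order. *)
Definition word_succ (s : nat * bool * seq nat) :
    seq (nat * (nat * bool * seq nat)) :=
  let: (m, b, st) := s in
  (m.+1, (m.+1, true, if b then m :: st else st)) ::
  (if b then [:: (m, (m, false, st))] else [::]) ++
  (if st is a :: st' then [:: (a, (m, b, st'))] else [::]).

Definition word_final (s : nat * bool * seq nat) : bool :=
  let: (m, b, st) := s in ~~ b && (st == [::]).

Definition row (k : nat) : seq nat := if k is 0 then [::] else [:: k].

(** From (k, 1) only removals remain: enlarging the first row is forbidden, and any other addition
    leaves the family. *)
Definition shape_next (la : seq nat) : seq (seq nat) :=
  match la with
  | [::] => [:: [:: 1]]
  | [:: k] => [:: [:: k.+1]; row k.-1; [:: k; 1]]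
  | [:: k; 1] => [:: k] :: (if k is k'.+2 then [:: [:: k'.+1; 1]] else [::])
  | _ => [::]
  end.

(** Each step is labelled by its target, so a run is a tableau without its initial empty shape. *)
Definition shape_succ (la : seq nat) : seq (seq nat * seq nat) :=
  [seq (mu, mu) | mu <- shape_next la].

Notation word_runs := (runs word_succ word_final).
Notation shape_runs := (runs shape_succ (pred1 [::])).

(* While [b] holds, the last opener stands both for a square added to the first
   row and for one added to the second row, whence the sum. *)
Lemma size_word_runs N m b st :
  size (word_runs N (m, b, st)) =
  if b then
    size (shape_runs N (row (size st).+1)) +
    (if st is [::] then 0 else size (shape_runs N [:: size st; 1]))
  else size (shape_runs N (row (size st))).
Proof.
elim: N m b st => [|N IH] m b st.
  by case: b st => [] [|a st].
rewrite !size_runsS.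
(* If [b] holds and [st] has h > 0 entries, opening matches the additions to the row (h+1), closing
   [m] the removal from it, and closing the head of [st] the moves from (h, 1). If [b] fails,
   opening matches both additions to the row (h), and closing the removal. *)
case: b st => [] [|a [|c st]]; rewrite ?size_runsS /= ?IH /=; lia.
Qed.

(** * Steps between restricted shapes *)

Definition near_row (la : seq nat) : bool := is_partn la && row_or_near_row la.

Lemma add_squareE la mu :
  add_square la mu = has (fun i => mu == incr_nth la i) (iota 0 (size la).+1).
Proof.
apply/existsP/hasP => [[i /eqP ->]|[i]].
  by exists (nat_of_ord i); rewrite // mem_iota ltn_ord.
by rewrite mem_iota => /= li /eqP ->; exists (Ordinal li).
Qed.

Lemma near_rowP la : near_row la ->
  [\/ la = [::], exists k, la = [:: k.+1] | exists k, la = [:: k.+1; 1]].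
Proof.
rewrite /near_row /is_partn.
case: la => [|[|k] [|[|[|c]] [|d la]]] //=; rewrite ?inE ?andbF //= => _.
- by constructor 1.
- by constructor 2; exists k.
- by constructor 3; exists k.
Qed.

(** Every listed successor stays in the family; for two shapes of the family, nine pairs of forms
    remain, each settled by arithmetic. *)
Lemma mem_shape_next la mu : near_row la ->
  (mu \in shape_next la) =
  [&& near_row mu, osc_step la mu & ~~ forbidden_step la mu].
Proof.
move=> gla; have [gmu|/negP gmu] := boolP (near_row mu); last first.
  apply/negP; case/near_rowP: gla => [->|[k ->]|[[|k] ->]] /=;
    rewrite !inE.
  - by move/eqP=> mE; rewrite mE in gmu.
  - by case/or3P => /eqP mE; rewrite mE in gmu; case: k gmu {mE}.
  - by case/eqP => mE; rewrite mE in gmu.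
  - by case/orP => /eqP mE; rewrite mE in gmu.
rewrite /osc_step !add_squareE.
case/near_rowP: gla => [->|[k ->]|[[|k] ->]];
case/near_rowP: gmu => [->|[l ->]|[l ->]] //=;
rewrite ?inE ?eqseq_cons ?andbT ?andbF ?orbF //=.
all: try by case: k.
all: try lia.
all: by case: k => [|k] //=; rewrite ?eqseq_cons /= ?andbT ?andbF ?orbF //; lia.
Qed.

(** * Accepted words in terms of prefixes *)

(* The condition on the letter [x] following the prefix [p]: either it opens
   the next label, or it closes an open label and no other open label above it,
   except possibly the largest label of [p], remains. *)
Definition legal (p : seq nat) (x : nat) : Prop :=
  (0 < x /\ forall y, (y \in p) = (0 < y < x)) \/
  (count_mem x p = 1 /\
   forall y c, x < y -> y < c -> c \in p -> count_mem y p <> 1).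

(** A label is open when it has occurred exactly once, so the state is read off the multiplicities
    in the prefix. *)
Definition word_state (p : seq nat) (s : nat * bool * seq nat) : Prop :=
  let: (m, b, st) := s in
  [/\ forall y, (y \in p) = (0 < y <= m),
      b = (count_mem m p == 1),
      sorted gtn st,
      forall y, (y \in st) = (y < m) && (count_mem y p == 1)
    & forall y, count_mem y p <= 2].

Lemma count_mem_rcons (T : eqType) (x y : T) (s : seq T) :
  count_mem x (rcons s y) = count_mem x s + (y == x).
Proof. by rewrite -cats1 count_cat /= addn0. Qed.

Lemma word_succ_legal p s x s' : word_state p s -> (x, s') \in word_succ s ->
  legal p x /\ word_state (rcons p x) s'.
Proof.
case: s => [[m b] st] [pE bE st_sorted stE c2] /=; rewrite inE mem_cat.
case/or3P.
- case/eqP => -> ->.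
  have c0 : count_mem m.+1 p = 0.
    by apply/count_memPn; rewrite pE; lia.
  split; first by left; split=> // y; rewrite pE.
  split.
  + by move=> y; rewrite mem_rcons inE pE; lia.
  + by rewrite count_mem_rcons c0 eqxx.
  + case: (b) => //=; case: (st) st_sorted stE => //= a st' sta stE.
    by rewrite sta andbT; have := stE a; rewrite inE eqxx /=; lia.
  + move=> y; rewrite count_mem_rcons.
    by case: b bE => bE; rewrite ?inE stE; case: (eqVneq y m) => [->|ym]; lia.
  + move=> y; rewrite count_mem_rcons; have := c2 y.
    by case: (eqVneq m.+1 y) => [<-|]; lia.
- case: b bE => // /esym/eqP cm; rewrite inE => /eqP [-> ->].
  split.
    right; split=> // y c my yc; rewrite pE => ? ?; lia.
  split=> //.
  + move=> y; rewrite mem_rcons inE pE.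
    have : m \in p by rewrite -has_pred1 has_count cm.
    by rewrite pE; lia.
  + by rewrite count_mem_rcons cm eqxx.
  + by move=> y; rewrite count_mem_rcons stE; lia.
  + move=> y; rewrite count_mem_rcons; have := c2 y.
    by case: (eqVneq m y) => [<-|]; lia.
case: st st_sorted stE => // a st st_sorted stE; rewrite inE => /eqP [-> ->].
have := stE a; rewrite mem_head => /esym/andP [am /eqP ca].
have st_lt y : y \in st -> y < a.
  by move/(allP (order_path_min (rev_trans ltn_trans) st_sorted)).
split.
  (* An open label y with a < y < m would belong to the stack, whose largest entry is its head a. *)
  right; split=> // y c ay yc; rewrite pE => cm cy.
  have : y \in a :: st by rewrite stE cy eqxx; lia.
  by rewrite inE => /predU1P [|/st_lt]; lia.
split.
- move=> y; rewrite mem_rcons inE pE.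
  have : a \in p by rewrite -has_pred1 has_count ca.
  by rewrite pE; lia.
- by rewrite count_mem_rcons bE; lia.
- exact: path_sorted st_sorted.
- move=> y; rewrite count_mem_rcons; have := stE y; rewrite inE.
  case: (eqVneq y a) => [->|ya] /=; last by move=> ->; lia.
  by rewrite ca; case: (boolP (a \in st)) => [/st_lt|]; lia.
- move=> y; rewrite count_mem_rcons; have := c2 y.
  by case: (eqVneq a y) => [<-|]; lia.
Qed.

Lemma legal_word_succ p s x : word_state p s -> legal p x ->
  exists s', (x, s') \in word_succ s.
Proof.
case: s => [[m b] st] [pE bE st_sorted stE c2] /=.
case=> [[x0 xE]|[cx maxx]].
  exists (m.+1, true, if b then m :: st else st).
  have E y : (0 < y <= m) = (0 < y < x) by rewrite -pE xE.
  (* At [x] the equality gives m < x, at its predecessor x - 1 <= m. *)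
  have -> : x = m.+1 by move: (E x) (E x.-1); lia.
  by rewrite mem_head.
have : x \in p by rewrite -has_pred1 has_count cx.
rewrite pE => /andP [x0]; rewrite leq_eqVlt => /predU1P [xm|xm].
  subst x; exists (m, false, st).
  by rewrite bE cx eqxx inE mem_cat inE eqxx orbT.
have xst : x \in st by rewrite stE xm cx.
case: st st_sorted stE xst => // a st st_sorted stE xst.
have := stE a; rewrite mem_head => /esym/andP [am /eqP ca].
exists (m, b, st); suff -> : x = a by rewrite inE mem_cat mem_head !orbT.
move: xst; rewrite inE => /predU1P [//|xst].
have xa : x < a := allP (order_path_min (rev_trans ltn_trans) st_sorted) _ xst.
(* Were x below the head a, then a would be an open label between x and m, against legality. *)
by case: (maxx a m) => //; rewrite pE; lia.
Qed.

Lemma word_finalE p s : word_state p s ->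
  reflect (forall y, y \in p -> count_mem y p = 2) (word_final s).
Proof.
case: s => [[m b] st] [pE bE st_sorted stE c2] /=.
apply: (iffP andP) => [[nb /eqP st0] y yp|c_eq2].
  have cy : 0 < count_mem y p by rewrite -has_count has_pred1.
  move: nb yp (c2 y) (stE y); rewrite st0 pE bE in_nil.
  case: (eqVneq y m) cy => [->|]; move: (count_mem m p) (count_mem y p) => cm cy; lia.
split.
  rewrite bE; apply/negP => /eqP cm.
  by have := c_eq2 m; rewrite -has_pred1 has_count cm => /(_ isT).
case: st stE {st_sorted} => // a st stE.
have := stE a; rewrite mem_head => /esym/andP [am /eqP ca].
by have := c_eq2 a; rewrite ca -has_pred1 has_count ca => /(_ isT).
Qed.

(** The prefix is arbitrary because the induction moves the first letter of [w] to the end of [p];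
    at each letter, legality is equivalent to the existence of a transition. *)
Lemma word_acceptsP p s w : word_state p s ->
  accepts word_succ word_final s w <->
  (forall u x v, w = u ++ x :: v -> legal (p ++ u) x) /\
  (forall y, y \in p ++ w -> count_mem y (p ++ w) = 2).
Proof.
elim: w p s => [|x w IH] p s ps /=.
  rewrite cats0; split=> [/(word_finalE ps) c2|[_ c2]].
    by split=> // [[]].
  by apply/(word_finalE ps).
split.
  case/hasP => [[x' s']] xs' /andP [/eqP /= x'x]; rewrite {}x'x in xs'.
  have [px ps'] := word_succ_legal ps xs'.
  move/(IH _ _ ps'); rewrite cat_rcons => [[leg c2]]; split=> //.
  move=> [|z u] y v /=; first by case=> <- _; rewrite cats0.
  by case=> <- /leg; rewrite cat_rcons.
case=> leg c2.
have px : legal p x by have := leg [::] x w erefl; rewrite cats0.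
have [s' xs'] := legal_word_succ ps px.
apply/hasP; exists (x, s') => //=; rewrite eqxx /=.
apply/(IH (rcons p x)); first by have [] := word_succ_legal ps xs'.
rewrite cat_rcons; split=> // u y v wE.
by rewrite cat_rcons; apply: (leg _ _ v); rewrite wE.
Qed.

(** * Restricted growth and the pattern 12312 *)

(** Restricted growth: new letters appear in the order 1, 2, 3, and so on. *)
Definition rg_word (w : seq nat) : Prop :=
  forall u x v, w = u ++ x :: v -> x \notin u ->
  0 < x /\ forall y, (y \in u) = (0 < y < x).

Definition good_word (w : seq nat) : Prop :=
  [/\ rg_word w, forall y, y \in w -> count_mem y w = 2
    & forall a b c, a < b -> b < c -> ~~ subseq [:: a; b; c; a; b] w].

Lemma subseq_cat_cons (T : eqType) (s1 s2 : seq T) (x : T) (w : seq T) :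
  subseq (s1 ++ x :: s2) w ->
  exists u v, [/\ w = u ++ x :: v, subseq s1 u & subseq s2 v].
Proof.
elim: w s1 => [|z w IH] [|y s1] //=.
  case: eqP => [<- sw|_ sw]; first by exists [::], w.
  have [u [v [-> s1u s2v]]] := IH [::] sw.
  by exists (z :: u), v; split=> //; rewrite sub0seq.
case: (eqVneq y z) => [->|yz] sw.
  have [u [v [-> s1u s2v]]] := IH s1 sw.
  by exists (z :: u), v; split=> //=; rewrite eqxx.
have [u [v [-> s1u s2v]]] := IH (y :: s1) sw.
by exists (z :: u), v; split=> //=; rewrite (negPf yz).
Qed.

(** In a b c a b the second a is illegal, since b is open below c. Conversely, an illegal closer x
    leaves an open y below some c already read; restricted growth puts x, y, c in this order, and y
    returns after x. *)
Lemma accepts_good_word w :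
  accepts word_succ word_final (0, false, [::]) w <-> good_word w.
Proof.
have init : word_state [::] (0, false, [::]) by split=> // y; rewrite ?in_nil; lia.
rewrite (word_acceptsP w init) /=; split=> [[leg c2]|[rg c2 avoid]].
  split=> // [u x v wE xu|a b c ab bc].
    case: (leg u x v wE) => // [[cx _]].
    by move: xu; rewrite -has_pred1 has_count cx.
  apply/negP => /(@subseq_cat_cons _ [:: a; b; c] [:: b]).
  case=> u [v [wE su]]; rewrite sub1seq => bv.
  have [au bu cu] : [/\ a \in u, b \in u & c \in u].
    by split; apply: (mem_subseq su); rewrite !inE eqxx ?orbT.
  case: (leg u a v wE) => [[_ uE]|[_ /(_ b c ab bc cu)]].
    by move: au; rewrite uE ltnn andbF.
  apply; have := c2 b; rewrite wE mem_cat bu count_cat /= => /(_ isT).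
  move: bu bv; rewrite -!has_pred1 !has_count.
  by move: (count_mem b u) (count_mem b v) => k l; lia.
split=> // u x v wE.
have [xu|xu] := boolP (x \in u); last by left; exact: rg wE xu.
have cw y : y \in u -> count_mem y u + (x == y) + count_mem y v = 2.
  move=> yu; have := c2 y.
  by rewrite wE mem_cat yu count_cat /= => /(_ isT) <-; rewrite addnA.
right; split.
  by have := cw x xu; move: xu; rewrite eqxx -has_pred1 has_count; lia.
move=> y c xy yc cu cy; have /negP := avoid x y c xy yc; apply.
(* Cuts an initial segment of [u] at the first occurrence of z. Applied to [u] at c, then to the
   part before c at y, it puts y before c and x before y. *)
have first_occ z s1 s2 : u = s1 ++ s2 -> z \in s1 ->
    exists t1 t2, [/\ s1 = t1 ++ z :: t2, 0 < z &
      forall k, (k \in t1) = (0 < k < z)].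
  move=> uE zs1; exists (take (index z s1) s1), (drop (index z s1).+1 s1).
  have s1E : s1 = take (index z s1) s1 ++ z :: drop (index z s1).+1 s1.
    by rewrite -{2}(nth_index 0 zs1) -drop_nth ?index_mem // cat_take_drop.
  have [||z0 zE] := rg (take (index z s1) s1) z
    (drop (index z s1).+1 s1 ++ s2 ++ x :: v); last by split.
    by rewrite wE uE {1}s1E -!catA.
  by rewrite in_take_leq ?index_size // ltnn.
have [t1 [t2 [uE _ t1E]]] := first_occ c u [::] (esym (cats0 u)) cu.
have yt1 : y \in t1 by rewrite t1E yc; lia.
have [t3 [t4 [t1E' _ t3E]]] := first_occ y t1 (c :: t2) uE yt1.
have [_ [_ [_ x0 _]]] := first_occ x u [::] (esym (cats0 u)) xu.
have xt3 : x \in t3 by rewrite t3E xy x0.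
have yv : y \in v.
  have yu : y \in u by rewrite uE mem_cat yt1.
  have := cw y yu; rewrite cy (ltn_eqF xy) -has_pred1 has_count.
  by move: (count_mem y v) => k; lia.
rewrite wE uE t1E' -!catA.
rewrite (@cat_subseq _ [:: x] [:: y; c; x; y]) ?sub1seq //= eqxx.
rewrite (@cat_subseq _ [::] [:: c; x; y]) ?sub0seq //= eqxx.
rewrite (@cat_subseq _ [::] [:: x; y]) ?sub0seq //= eqxx.
by rewrite sub1seq.
Qed.

Lemma word_contains_12312 w :
  reflect (exists a b c, [/\ a < b, b < c & subseq [:: a; b; c; a; b] w])
          (word_contains w [:: 1; 2; 3; 1; 2]).
Proof.
apply: (iffP existsP) => [[t /andP []]|[a [b [c [ab bc /subseqP [t sz mE]]]]]].
  have := mask_subseq t w.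
  case: (mask t w) => [|a [|b [|c [|d [|e [|]]]]]] // sub _ /forallP o.
  have O i j (hi : i < 5) (hj : j < 5) :
     (nth 0 [:: a; b; c; d; e] i < nth 0 [:: a; b; c; d; e] j) =
     (nth 0 [:: 1; 2; 3; 1; 2] i < nth 0 [:: 1; 2; 3; 1; 2] j).
    by have /forallP /(_ (Ordinal hj)) /eqP := o (Ordinal hi).
  (* Equality of two letters is the failure of both strict comparisons, hence both orders for the
     pairs (0, 3) and (1, 4). *)
  have := O 0 1 isT isT; have := O 1 2 isT isT.
  have := O 0 3 isT isT; have := O 3 0 isT isT.
  have := O 1 4 isT isT; have := O 4 1 isT isT => /=.
  move=> eb be da ad bc ab.
  have da' : d = a by lia.
  have eb' : e = b by lia.
  by exists a, b, c; split; rewrite ?ab ?bc //; rewrite -{2}da' -{2}eb'.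
have szt : size t == size w by rewrite sz.
exists (Tuple szt); rewrite /= -mE; apply/andP; split=> //.
apply/forallP => i; apply/forallP => j; apply/eqP.
case: i j => [[|[|[|[|[|i]]]]] hi] [[|[|[|[|[|j]]]]] hj] //=; lia.
Qed.

(** Read from left to right: a repeated letter is fixed by the kernel, and a new letter by the set
    of letters before it. *)
Lemma rg_word_kernel_inj w w' :
  rg_word w -> rg_word w' -> size w = size w' ->
  (forall i j, i < size w -> j < size w ->
     (nth 0 w i == nth 0 w j) = (nth 0 w' i == nth 0 w' j)) ->
  w = w'.
Proof.
move=> rg rg' sz ker.
suff takeE k : k <= size w -> take k w = take k w'.
  by rewrite -[w]take_size takeE // sz take_size.
elim: k => [|k IH] kw; first by rewrite !take0.
rewrite (take_nth 0 kw) (take_nth 0) -?sz // IH 1?ltnW //; congr rcons.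
have split_at (v : seq nat) : k < size v -> v = take k v ++ nth 0 v k :: drop k.+1 v.
  by move=> kv; rewrite -drop_nth // cat_take_drop.
have seen (v v' : seq nat) : k < size v -> size v = size v' ->
    (forall i j, i < size v -> j < size v ->
      (nth 0 v i == nth 0 v j) = (nth 0 v' i == nth 0 v' j)) ->
    take k v = take k v' -> nth 0 v k \in take k v -> nth 0 v k = nth 0 v' k.
  move=> kv szv kerv tE /(nthP 0) [i]; rewrite size_takel ?(ltnW kv) // => ik.
  rewrite nth_take // => iE.
  have iv := ltn_trans ik kv.
  have /eqP <- : nth 0 v' i == nth 0 v' k by rewrite -kerv // iE.
  by rewrite -iE -(nth_take 0 ik v) tE nth_take.
have kw' : k < size w' by rewrite -sz.
have tE := IH (ltnW kw).
have [xu|xu] := boolP (nth 0 w k \in take k w); first exact: seen.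
have [xu'|xu'] := boolP (nth 0 w' k \in take k w').
  by apply/esym/seen => // i j hi hj; rewrite ker ?sz.
have [x0 xE] := rg _ _ _ (split_at w kw) xu.
have [x0' xE'] := rg' _ _ _ (split_at w' kw') xu'.
have E y : (0 < y < nth 0 w k) = (0 < y < nth 0 w' k) by rewrite -xE -xE' tE.
by move: (E (nth 0 w k)) (E (nth 0 w' k)); lia.
Qed.

(** * Canonical forms of matchings *)

Lemma edge_min_le m (B : {set 'I_m}) (i : 'I_m) : i \in B -> edge_min B <= i.
Proof.
move=> iB; rewrite /edge_min; have := mem_index_enum i.
elim: (index_enum _) => //= j s IH; rewrite inE big_cons => /predU1P [<-|/IH].
  by rewrite iB geq_minl.
by case: ifP => // _; exact: leq_trans (geq_minr _ _).
Qed.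

Lemma edge_min_mem m (B : {set 'I_m}) (i : 'I_m) : i \in B ->
  exists2 j : 'I_m, j \in B & edge_min B = j.
Proof.
move=> iB; case: (arg_minnP (fun j : 'I_m => j : nat) iB) => j jB jmin.
exists j => //; apply/eqP; rewrite eqn_leq edge_min_le //=.
(* The neutral value [m] exceeds every index, so it respects the lower bound [j]. *)
rewrite /edge_min; apply: (big_ind (leq j)) => // [|x y jx jy].
  exact/ltnW/ltn_ord.
by rewrite leq_min jx.
Qed.

Lemma edge_label_lt m (M : {set {set 'I_m}}) B C : C \in M ->
  edge_min B < edge_min C -> edge_label M B < edge_label M C.
Proof.
move=> MC BC; apply/proper_card/properP; split.
  by apply/subsetP => D; rewrite !inE => /andP [-> /leq_trans ->] //; apply: ltnW.
by exists C; rewrite !inE MC ?leqnn // -ltnNge.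
Qed.

(** Labels increase strictly with the minimum, and two blocks with the same minimum meet, hence
    coincide. *)
Lemma edge_label_inj m (M : {set {set 'I_m}}) :
  trivIset M -> set0 \notin M -> {in M &, injective (edge_label M)}.
Proof.
move=> tM M0 B C MB MC BC.
have [minlt|minlt|minE] := ltngtP (edge_min B) (edge_min C).
- by have := edge_label_lt MC minlt; rewrite BC ltnn.
- by have := edge_label_lt MB minlt; rewrite BC ltnn.
have inh (D : {set 'I_m}) : D \in M -> exists i, i \in D.
  by move=> MD; apply/set0Pn; apply: contraNneq M0 => <-.
have [i iB] := inh B MB; have [k kC] := inh C MC.
have [j jB jE] := edge_min_mem iB; have [l lC lE] := edge_min_mem kC.
have jl : j = l by apply: val_inj; rewrite /= -jE -lE.
by rewrite -(def_pblock tM MB jB) jl (def_pblock tM MC lC).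
Qed.

Lemma edge_label_gt0 m (M : {set {set 'I_m}}) B : B \in M -> 0 < edge_label M B.
Proof. by move=> MB; apply/card_gt0P; exists B; rewrite !inE MB leqnn. Qed.

(** Pigeonhole: the labels are distinct and lie between 1 and the number of blocks. *)
Lemma edge_label_surj m (M : {set {set 'I_m}}) y :
  trivIset M -> set0 \notin M -> 0 < y <= #|M| ->
  exists2 B, B \in M & edge_label M B = y.
Proof.
move=> tM M0 yM.
have labels_uniq : uniq [seq edge_label M B | B <- enum M].
  rewrite map_inj_in_uniq ?enum_uniq // => B C; rewrite !mem_enum.
  exact: edge_label_inj.
have labels_le : {subset [seq edge_label M B | B <- enum M] <= iota 1 #|M|}.
  move=> _ /mapP [B + ->]; rewrite mem_enum mem_iota => MB.
  rewrite edge_label_gt0 //= add1n ltnS subset_leq_card //.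
  by apply/subsetP => C; rewrite inE => /andP [].
have [|_ labelsE] := uniq_min_size labels_uniq labels_le.
  by rewrite size_iota size_map -cardE.
have : y \in iota 1 #|M| by rewrite mem_iota add1n ltnS.
by rewrite -labelsE => /mapP [B + ->]; rewrite mem_enum; exists B.
Qed.

Lemma size_canonical_form m (M : {set {set 'I_m}}) : size (canonical_form M) = m.
Proof. by rewrite size_map size_enum_ord. Qed.

Lemma nth_canonical_form m (M : {set {set 'I_m}}) (i : 'I_m) :
  nth 0 (canonical_form M) i = edge_label M (pblock M i).
Proof. by rewrite (nth_map i) ?size_enum_ord // nth_ord_enum. Qed.

Lemma canonical_form_kernel m (M : {set {set 'I_m}}) (i j : 'I_m) :
  partition M [set: 'I_m] ->
  (nth 0 (canonical_form M) i == nth 0 (canonical_form M) j) =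
  (pblock M i == pblock M j).
Proof.
move=> /and3P [/eqP cM tM M0]; rewrite !nth_canonical_form.
apply/eqP/eqP => [|-> //]; apply: edge_label_inj => //;
  by rewrite pblock_mem ?cM ?inE.
Qed.

(** The blocks are the level sets of the canonical form, which therefore determines the matching. *)
Lemma canonical_formK m (M : {set {set 'I_m}}) : partition M [set: 'I_m] ->
  preim_partition (fun i : 'I_m => nth 0 (canonical_form M) i) [set: 'I_m] = M.
Proof.
move=> pM; rewrite -[RHS](preim_partition_pblock pM).
apply: eq_imset => i; apply/setP => j; rewrite !inE /=.
exact: canonical_form_kernel.
Qed.

(** A new label occurs at the minimum of its block, and the labels already seen are those of the
    blocks with smaller minimum. *)
Lemma canonical_form_rg m (M : {set {set 'I_m}}) :
  partition M [set: 'I_m] -> rg_word (canonical_form M).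
Proof.
move=> pM; have /and3P [/eqP cM tM M0] := pM.
move=> u x v wE xu.
have um : size u < m.
  by rewrite -(size_canonical_form M) wE size_cat /= -addSnnS leq_addr.
pose j := Ordinal um.
have inM (i : 'I_m) : pblock M i \in M by rewrite pblock_mem ?cM ?inE.
have inB (i : 'I_m) : i \in pblock M i by rewrite mem_pblock cM inE.
have xE : x = edge_label M (pblock M j).
  by rewrite -nth_canonical_form wE nth_cat ltnn subnn.
have uE (i : 'I_m) : i < j -> edge_label M (pblock M i) \in u.
  by move=> ij; rewrite -nth_canonical_form wE nth_cat ij mem_nth.
have minj : edge_min (pblock M j) = j.
  have [i iB iE] := edge_min_mem (inB j).
  rewrite iE; apply/eqP; rewrite eqn_leq -{1}iE edge_min_le //= leqNgt.
  apply: contra xu => /uE; rewrite xE.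
  by rewrite (def_pblock tM (inM j) iB).
split; first by rewrite xE edge_label_gt0.
move=> y; apply/idP/idP => [/(nthP 0) [i iu yE]|/andP [y0 yx]].
  have im := ltn_trans iu um.
  have {}yE : y = edge_label M (pblock M (Ordinal im)).
    by rewrite -nth_canonical_form wE nth_cat /= iu yE.
  rewrite yE edge_label_gt0 // xE edge_label_lt // minj.
  exact: leq_ltn_trans (edge_min_le (inB (Ordinal im))) iu.
have [|B MB yE] := @edge_label_surj _ M y tM M0.
  rewrite y0 (leq_trans (ltnW yx)) // xE subset_leq_card //.
  by apply/subsetP => C; rewrite inE => /andP [].
have [k kB] : exists i, i \in B by apply/set0Pn; apply: contraNneq M0 => <-.
have [i iB iE] := edge_min_mem kB.
rewrite -yE -(def_pblock tM MB iB); apply: uE.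
(* If the minimum of [B] were not before [j], the label y of [B] would be at least x. *)
rewrite ltnNge; apply: contraTN yx; rewrite -leqNgt xE -yE => ji.
apply/subset_leq_card/subsetP => C; rewrite !inE minj iE => /andP [-> /leq_trans].
exact.
Qed.

Lemma count_canonical_form m (M : {set {set 'I_m}}) (i : 'I_m) :
  partition M [set: 'I_m] ->
  count_mem (nth 0 (canonical_form M) i) (canonical_form M) = #|pblock M i|.
Proof.
move=> pM; have /and3P [/eqP cM tM M0] := pM.
rewrite count_map enumT -size_filter cardE; congr size; apply: eq_filter => j /=.
rewrite -nth_canonical_form canonical_form_kernel // eq_sym eq_pblock //.
by rewrite cM inE.
Qed.

Lemma matching_good_word n (M : {set {set 'I_(2 * n)}}) :
  is_matching M -> avoids M [:: 1; 2; 3; 1; 2] -> good_word (canonical_form M).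
Proof.
move=> /and3P [pM _ /forallP M2] aM; split.
- exact: canonical_form_rg.
- have /and3P [/eqP cM _ _] := pM.
  move=> _ /(nthP 0) [i + <-]; rewrite size_canonical_form => im.
  rewrite (count_canonical_form (Ordinal im) pM); apply/eqP.
  by have /implyP := M2 (pblock M (Ordinal im)); apply; rewrite pblock_mem ?cM ?inE.
- move=> a b c ab bc; apply: contraNN aM => sub.
  by apply/word_contains_12312; exists a, b, c.
Qed.

(** Take the level sets of [w] as edges: the canonical form then has the same kernel as [w], and
    restricted growth makes the two words equal. *)
Lemma good_word_matching n w : good_word w -> size w = 2 * n ->
  exists M : {set {set 'I_(2 * n)}},
    is_matching M && avoids M [:: 1; 2; 3; 1; 2] /\ canonical_form M = w.
Proof.
move=> [rg c2 aw] sz.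
pose f (i : 'I_(2 * n)) := nth 0 w i.
pose M := preim_partition f [set: 'I_(2 * n)].
have pM : partition M [set: 'I_(2 * n)] := preim_partitionP f _.
have /and3P [/eqP cM tM M0] := pM.
have kerM (i j : 'I_(2 * n)) : (pblock M i == pblock M j) = (f i == f j).
  rewrite eq_pblock ?cM ?inE // pblock_equivalence_partition ?inE //.
  by split=> // /eqP ->.
have wE : canonical_form M = w.
  apply: rg_word_kernel_inj => //; first exact: canonical_form_rg.
    by rewrite size_canonical_form sz.
  move=> i j; rewrite size_canonical_form => hi hj.
  by rewrite (canonical_form_kernel (Ordinal hi) (Ordinal hj)) // kerM.
have M2 : {in M, forall B : {set 'I_(2 * n)}, #|B| = 2}.
  move=> B MB; have [i iB] : exists i, i \in B.
    by apply/set0Pn; apply: contraNneq M0 => <-.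
  rewrite -(def_pblock tM MB iB) -count_canonical_form // wE c2 //.
  by rewrite mem_nth // sz.
exists M; split=> //; apply/andP; split; last first.
  rewrite /avoids wE; apply/word_contains_12312 => [[a [b [c [ab bc]]]]].
  by apply/negP; exact: aw.
apply/and3P; split=> //; last by apply/forallP => B; apply/implyP => /M2 ->.
have := card_uniform_partition M2 pM; rewrite cardsT card_ord => /eqP.
by rewrite [_ * 2]mulnC eqn_pmul2l // eq_sym.
Qed.

(** * Restricted tableaux as accepted words *)

Lemma accepts_shape la s : near_row la ->
  accepts shape_succ (pred1 [::]) la s =
  [&& all near_row s, path osc_step la s,
      path [rel x y | ~~ forbidden_step x y] la s & last la s == [::]].
Proof.
elim: s la => [|mu s IH] la gla //=.
have -> : has (fun p => (p.1 == mu) && accepts shape_succ (pred1 [::]) p.2 s)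
      (shape_succ la) =
    (mu \in shape_next la) && accepts shape_succ (pred1 [::]) mu s.
  rewrite /shape_succ has_map; apply/hasP/andP.
    by case=> nu /= la_nu /andP [/eqP <-].
  by case=> la_mu acc; exists mu; rewrite //= eqxx.
rewrite mem_shape_next //; case gmu: (near_row mu) => //=; rewrite IH //.
by case: (osc_step la mu); case: (forbidden_step la mu); rewrite ?andbF.
Qed.

Lemma restricted_osc_tableauE l (t : l.+1.-tuple (seq nat)) :
  restricted_osc_tableau t =
  (thead t == [::]) && accepts shape_succ (pred1 [::]) [::] (behead t).
Proof.
rewrite /restricted_osc_tableau /is_osc_tableau.
case/tupleP: t => la s; rewrite theadE /=.
rewrite !(tnth_nth [::]) /=.
have -> : nth [::] (la :: s) l = last la s.
  by rewrite -[RHS]/(last [::] (la :: s)) -nth_last /= size_tuple.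
have [->|] := eqVneq la [::]; rewrite ?andbF //=.
rewrite accepts_shape // (all_predI is_partn row_or_near_row).
case: (all is_partn s) => //=; case: (last _ _ == _); rewrite ?andbF ?andbT //.
by case: (path osc_step _ _); rewrite ?andbF.
Qed.

(** * Duplicate-free enumerations and the bijection *)

Lemma shape_runs_uniq N la : uniq (shape_runs N la).
Proof.
apply: (@runs_uniq _ _ _ _ (fun _ => True)) => // {}la _.
rewrite /unzip1 /shape_succ -map_comp map_id.
case: la => [|k [|[|[|c]] [|d la]]] //=;
  by case: k => [|[|k]] //=; rewrite !inE !eqseq_cons /=; lia.
Qed.

(** The labels m+1, m and the head of the stack differ because the head is below m, a fact supplied
    by the invariant [word_state]. *)
Lemma word_runs_uniq N : uniq (word_runs N (0, false, [::])).
Proof.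
apply: (@runs_uniq _ _ _ _ (fun s => exists p, word_state p s)).
- move=> s [x s'] [p ps] xs'; exists (rcons p x).
  by have [] := word_succ_legal ps xs'.
- move=> [[m b] st] [p [pE bE st_sorted stE c2]] /=.
  case: st st_sorted stE => [|a st] _ stE.
    by case: b bE; rewrite //= inE; lia.
  have := stE a; rewrite mem_head => /esym/andP [am _].
  case: b bE => _ /=; rewrite !inE; lia.
by exists [::]; split=> // y; rewrite ?in_nil; lia.
Qed.

(** Each element is sent to the position of its image in [s]; sets enumerated by lists of equal
    length can thus be matched through ordinals. *)
Lemma bijective_enumeration (A : choiceType) (B : eqType) (f : A -> B) (s : seq B) :
  injective f -> uniq s -> (forall a, f a \in s) ->
  (forall b, b \in s -> exists a, f a = b) ->
  exists g : A -> 'I_(size s), bijective g.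
Proof.
move=> f_inj us fs sf.
have idx a : index (f a) s < size s by rewrite index_mem.
have pre (i : 'I_(size s)) : exists a, f a == tnth (in_tuple s) i.
  by have [a <-] := sf _ (mem_tnth i (in_tuple s)); exists a.
exists (fun a => Ordinal (idx a)).
exists (fun i => xchoose (pre i)) => [a|i].
  apply: f_inj; rewrite (eqP (xchooseP (pre _))).
  by rewrite (tnth_nth (f a)) /= nth_index.
apply: val_inj; rewrite /= (eqP (xchooseP (pre _))).
by rewrite (tnth_nth (tnth (in_tuple s) i)) /= index_uniq.
Qed.

Theorem theorem4 (n : nat) (hn : 1 <= n) :
  exists f : {M : {set {set 'I_(2 * n)}} |
                is_matching M && avoids M [:: 1; 2; 3; 1; 2]} ->
             {t : (2 * n).+1.-tuple (seq nat) | restricted_osc_tableau t},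
    bijective f.
Proof.
have sizeE : size (shape_runs (2 * n) [::]) =
             size (word_runs (2 * n) (0, false, [::])).
  by rewrite size_word_runs.
have [|||w ws|g g_bij] := @bijective_enumeration
    {M : {set {set 'I_(2 * n)}} | is_matching M && avoids M [:: 1; 2; 3; 1; 2]}
    _ (fun M => canonical_form (val M)) (word_runs (2 * n) (0, false, [::])).
- move=> [M MP] [M' MP'] /= E; apply: val_inj => /=.
  have /andP [/and3P [pM _ _] _] := MP; have /andP [/and3P [pM' _ _] _] := MP'.
  by rewrite -(canonical_formK pM) E canonical_formK.
- exact: word_runs_uniq.
- move=> [M MP]; have /andP [mM aM] := MP; rewrite mem_runs size_canonical_form eqxx /=.
  by apply/accepts_good_word; apply: matching_good_word.
- move: ws; rewrite mem_runs => /andP [/eqP sz /accepts_good_word gw].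
  by have [M [MP <-]] := good_word_matching gw sz; exists (exist _ M MP).
have [|||s ss|h h_bij] := @bijective_enumeration
    {t : (2 * n).+1.-tuple (seq nat) | restricted_osc_tableau t}
    _ (fun t => behead (val t)) (shape_runs (2 * n) [::]).
- move=> [t tP] [t' tP'] /= E; apply/val_inj/val_inj => /=.
  move: tP tP' E; rewrite !restricted_osc_tableauE.
  case/tupleP: t => x t; case/tupleP: t' => x' t'; rewrite !theadE /=.
  by move=> /andP [/eqP -> _] /andP [/eqP -> _] ->.
- exact: shape_runs_uniq.
- move=> [t tP] /=; move: tP; rewrite mem_runs restricted_osc_tableauE.
  by case/andP => _ ->; rewrite size_behead size_tuple eqxx.
- move: ss; rewrite mem_runs => /andP [/eqP sz acc].
  have szs : size ([::] :: s) == (2 * n).+1 by rewrite /= sz.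
  have tP : restricted_osc_tableau (Tuple szs).
    by rewrite restricted_osc_tableauE /thead (tnth_nth [::]) /= acc.
  by exists (exist (fun t => is_true (restricted_osc_tableau t)) _ tP).
have [h' hK h'K] := h_bij.
(* The two index types agree only up to [sizeE], hence the cast between [g] and the inverse of
   [h]. *)
exists (fun M => h' (cast_ord (esym sizeE) (g M))).
apply: bij_comp; first by exists h.
apply: bij_comp g_bij.
by exists (cast_ord sizeE); [exact: cast_ordKV | exact: cast_ordK].
Qed.
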